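(* Let $\Gamma$ be a group. Set $G=\mathbb{Z}\wr\Gamma$ and $N=\bigoplus_{\Gamma}\mathbb{Z}$. Let $k\in\{1,2,3,\ldots\}$ and let $\lambda_1,\ldots,\lambda_k\in\Gamma\setminus\{e_\Gamma\}$. Let $\Lambda=\langle\lambda_1,\ldots,\lambda_k\rangle$ be the subgroup of $\Gamma$ generated by them. Set $$x_{(\lambda_1,\ldots,\lambda_k)}=\sum_{i=1}^k\delta_{\lambda_i}-k\,\delta_{e_\Gamma}\in N.$$ Then $$\mathrm{cl}_{G,N}(x_{(\lambda_1,\ldots,\lambda_k)})=\mathrm{int}\text{-}\mathrm{rk}^{\Gamma}(\Lambda).$$
   Context: $e_\Gamma$ is the identity of $\Gamma$. For groups $H,\Gamma$, the (restricted) wreath product is $H\wr\Gamma=\left(\bigoplus_\Gamma H\right)\rtimes\Gamma$, where $\Gamma$ acts by shifting coordinates: $(\lambda u)(\gamma)=u(\lambda^{-1}\gamma)$. Elements of $N=\bigoplus_\Gamma\mathbb{Z}$ are regarded as finitely supported functions $\Gamma\to\mathbb{Z}$; $N$ is a normal subgroup of $G$. For $\lambda\in\Gamma$, $\delta_\lambda\colon\Gamma\to\mathbb{Z}$ is the Kronecker delta function: $\delta_\lambda(\lambda)=1$ and $\delta_\lambda(\gamma)=0$ for $\gamma\neq\lambda$. For a group $G$ and a normal subgroup $N$, a mixed commutator is an element $[g,x]=gxg^{-1}x^{-1}$ with $g\in G$, $x\in N$; $[G,N]$ is the subgroup generated by mixed commutators, and for $x\in[G,N]$, $\mathrm{cl}_{G,N}(x)$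 is the smallest integer $n\ge 0$ such that $x$ is a product of $n$ mixed commutators. The rank of a group $\Lambda$ is $\mathrm{rk}(\Lambda)=\inf\{\#S\mid \Lambda=\langle S\rangle\}\in\mathbb{Z}_{\ge0}\cup\{\infty\}$. For a group $\Gamma$ and a subgroup $\Lambda$, the intermediate rank is $\mathrm{int}\text{-}\mathrm{rk}^\Gamma(\Lambda)=\inf\{\mathrm{rk}(\Theta)\mid \Lambda\leqslant\Theta\leqslant\Gamma\}\in\mathbb{Z}_{\ge0}\cup\{\infty\}$. *)

(* Defs.v *)
From HB Require Import structures.
From mathcomp Require Import all_boot all_order all_algebra.
From mathcomp Require Import finmap monalg.
From mathcomp Require Import boolp classical_sets functions cardinality.

Set Implicit Arguments.
Unset Strict Implicit.
Unset Printing Implicit Defensive.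

Import Order.TTheory GRing.Theory.

Local Open Scope classical_set_scope.

(* [None] is the value infinity of Z_{>=0} U {oo}. *)
Definition enat := option nat.

Definition enat_le (m n : enat) : bool :=
  match m, n with
  | _, None => true
  | None, Some _ => false
  | Some p, Some q => (p <= q)%N
  end.

Fact enat_display : Order.disp_t. Proof. exact: Order.Disp tt tt. Qed.

Fact enat_le_refl : reflexive enat_le.
Proof. by case=> //= n. Qed.

Fact enat_le_anti : antisymmetric enat_le.
Proof. by case=> [m|] [n|] //= /anti_leq->. Qed.

Fact enat_le_trans : transitive enat_le.
Proof. by case=> [n|] [m|] [p|] //=; apply: leq_trans. Qed.

Fact enat_le_total : total enat_le.
Proof. by case=> [m|] [n|] //=; apply: leq_total. Qed.

HB.instance Definition _ := Choice.on enat.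
HB.instance Definition _ := Order.Le_isPOrder.Build enat_display enat
  enat_le_refl enat_le_anti enat_le_trans.
HB.instance Definition _ :=
  Order.POrder_isTotal.Build enat_display enat enat_le_total.

(* The first argument of [infimum] is its value at the empty set. *)
Definition einf (P : set enat) : enat := infimum (None : enat) P.

Definition ecard (T : choiceType) (S : set T) : enat :=
  if `[< finite_set S >] then Some #|` fset_set S|%fset else None.

Section Group.
Local Open Scope group_scope.
Variable G : groupType.
Implicit Types (H K L N S : set G) (x : G).

Definition subgroup H : Prop :=
  [/\ H 1, (forall x y, H x -> H y -> H (x * y)) & (forall x, H x -> H x^-1)].

Definition gen S : set G := smallest subgroup S.

Definition rk H : enat := einf [set ecard S | S in [set S | gen S = H]].

Definition int_rk L : enat :=
  einf [set rk K | K in [set K | subgroup K /\ L `<=` K]].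

(* MathComp's [~ g, x] is g^-1 * x^-1 * g * x, which is another convention. *)
Definition mixed_commutators N : set G :=
  [set c | exists g x, N x /\ c = g * x * g^-1 * x^-1].

Definition mixed_commutator_subgroup N : set G := gen (mixed_commutators N).

(* The value is infinite outside [mixed_commutator_subgroup N]. *)
Definition mixed_cl N x : enat :=
  einf [set Some n | n in [set n | exists c : 'I_n -> G,
    (forall i, mixed_commutators N (c i)) /\ x = \prod_(i < n) c i]].

End Group.

Section Wreath.
Local Open Scope ring_scope.
(* [{malg A[T]}] is the type of finitely supported functions from T to A, with
   pointwise addition; [u@_c] is the value of u at c. *)
Variables (A : zmodType) (T : groupType).
Implicit Types (u v : {malg A[T]}) (a b c : T).

Definition shift a u : {malg A[T]} :=
  [malg c in [fset (a * b)%g | b in msupp u]%fset => u@_(a^-1 * c)%g].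

Lemma shiftE a u c : (shift a u)@_c = u@_(a^-1 * c)%g.
Proof.
rewrite mcoeffE; case: ifPn => // /negP nc.
rewrite mcoeff_outdom //; apply/negP => cu; apply: nc.
by apply/imfsetP; exists (a^-1 * c)%g => //=; rewrite mulVKg.
Qed.

Record wreath := Wreath { wbase : {malg A[T]}; wtop : T }.

Definition wreath_pair (g : wreath) := (wbase g, wtop g).
Definition pair_wreath (p : {malg A[T]} * T) := Wreath p.1 p.2.
Lemma wreath_pairK : cancel wreath_pair pair_wreath. Proof. by case. Qed.
HB.instance Definition _ := Choice.copy wreath (can_type wreath_pairK).

Definition wreath_one := Wreath 0 1%g.
Definition wreath_mul (g h : wreath) :=
  Wreath (wbase g + shift (wtop g) (wbase h)) (wtop g * wtop h)%g.
Definition wreath_inv (g : wreath) :=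
  Wreath (- shift (wtop g)^-1%g (wbase g)) (wtop g)^-1%g.

Fact wreath_mulA : associative wreath_mul.
Proof.
move=> [u a] [v b] [w c]; rewrite /wreath_mul /=; congr Wreath; last exact: mulgA.
by apply/malgP=> t; rewrite !(mcoeffD, shiftE) invgM addrA !mulgA.
Qed.

Fact wreath_mul1 : left_id wreath_one wreath_mul.
Proof.
move=> [u a]; rewrite /wreath_mul /= mul1g; congr Wreath.
by apply/malgP=> t; rewrite mcoeffD shiftE mcoeff0 add0r invg1 mul1g.
Qed.

Fact wreath_mulr1 : right_id wreath_one wreath_mul.
Proof.
move=> [u a]; rewrite /wreath_mul /= mulg1; congr Wreath.
by apply/malgP=> t; rewrite mcoeffD shiftE mcoeff0 addr0.
Qed.

Fact wreath_mulV : left_inverse wreath_one wreath_inv wreath_mul.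
Proof.
move=> [u a]; rewrite /wreath_mul /wreath_inv /wreath_one /= mulVg.
by congr Wreath; rewrite addNr.
Qed.

Fact wreath_mulrV : right_inverse wreath_one wreath_inv wreath_mul.
Proof.
move=> [u a]; rewrite /wreath_mul /wreath_inv /wreath_one /= mulgV.
congr Wreath; apply/malgP=> t.
by rewrite mcoeffD shiftE mcoeffN shiftE invgK mulVKg mcoeff0 subrr.
Qed.

HB.instance Definition _ := isGroup.Build wreath
  wreath_mulA wreath_mul1 wreath_mulr1 wreath_mulV wreath_mulrV.

(* The inclusion of the direct sum in the wreath product. *)
Definition of_base u : wreath := Wreath u 1%g.

Definition base_subgroup : set wreath := range of_base.

End Wreath.

Definition delta (T : groupType) (a : T) : {malg int[T]} := << a >>%R.

Definition xvec (T : groupType) (k : nat) (l : 'I_k -> T) : {malg int[T]} :=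
  (\sum_(i < k) delta (l i) - delta 1%g *+ k)%R.

(* Main.v *)
(* A product of [n] mixed commutators in [N] is a sum of [n] terms
   [a_i u_i - u_i].  Summing the coefficients of such an element over the
   subgroup generated by the [a_i] gives [0], while each summand
   [delta (lambda_i) - delta 1] contributes [0] or [-1] according to whether
   [lambda_i] lies in that subgroup or not; so all the [lambda_i] lie in it.
   Conversely, the [t] such that [delta (t * s) - delta s] is a sum of terms
   [a_i u_i - u_i] for every [s] form a subgroup containing the [a_i]. *)
Require Import Defs.
From HB Require Import structures.
From mathcomp Require Import all_boot all_order all_algebra.
From mathcomp Require Import finmap monalg.
From mathcomp Require Import boolp classical_sets functions cardinality.

Set Implicit Arguments.
Unset Strict Implicit.
Unset Printing Implicit Defensive.

Import Order.TTheory GRing.Theory Num.Theory.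

Local Open Scope classical_set_scope.

(** * Infima and cardinalities in the natural numbers with infinity *)

Lemma enat_minimum (P : set enat) : P !=set0 -> exists2 m, P m & lbound P m.
Proof.
case: (pselect (exists n, P (Some n))) => [Pfin _|Pinf [[n Pn|PN]]]; last first.
- by exists None => // -[n Pn|//]; case: Pinf; exists n.
- by case: Pinf; exists n.
have {Pfin} Pfin : exists n, `[< P (Some n) >].
  by have [n Pn] := Pfin; exists n; apply/asboolP.
case: (ex_minnP Pfin) => m /asboolP Pm mmin; exists (Some m) => //.
by move=> [n Pn|//]; apply: mmin; apply/asboolP.
Qed.

(** [infimum] picks from [infimums P] by choice, so that set must be shown inhabited; the minimum of
    [P] belongs to it. *)
Lemma einf_infimum (P : set enat) : P !=set0 -> infimums P (einf P).
Proof.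
move=> P0; have [m Pm mP] := enat_minimum P0.
rewrite /einf /infimum; case: ifPn => [/eqP PE|_].
  by move: P0; rewrite PE => -[].
case: xgetP => [y _ //|/(_ m)[]]; split=> //.
by move=> y; apply.
Qed.

Lemma einf_le (P : set enat) y : P y -> (einf P <= y)%O.
Proof. by move=> Py; have [+ _] := einf_infimum (ex_intro _ y Py); apply. Qed.

Lemma le_einf (P : set enat) z : (forall y, P y -> (z <= y)%O) -> (z <= einf P)%O.
Proof.
move=> zP; case: (pselect (P !=set0)) => [/einf_infimum[_]|/set0P/negP/negbNE PE].
  by apply.
(* Over the empty set the value is [None], the greatest element. *)
by rewrite /einf /infimum PE; case: z {zP}.
Qed.

(** Repeated values only lower the cardinality. With [ecard_range_ex], this lets families indexed by
    ['I_n] replace generating sets. *)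
Lemma ecard_range_le (T : choiceType) n (f : 'I_n -> T) :
  (ecard (range f) <= Some n)%O.
Proof.
have fin : finite_set (range f) by exact: finite_image.
rewrite /ecard (asboolT fin).
suff -> : fset_set (range f) = [fset f i | i in 'I_n]%fset.
  by apply: leq_trans (leq_imfset_card _ _ _) _; rewrite -cardE card_ord.
apply/fsetP => t; rewrite in_fset_set //; apply/idP/imfsetP => /=.
  by rewrite inE => -[i _ <-]; exists i.
by move=> [i _ ->]; rewrite inE; exists i.
Qed.

Lemma ecard_range_ex (T : choiceType) (S : set T) n : ecard S = Some n ->
  exists f : 'I_n -> T, range f = S.
Proof.
rewrite /ecard; case: ifP => // /asboolP Sfin [<-].
exists (tnth (in_tuple (fset_set S))); rewrite -[RHS](fset_setK Sfin).
apply/seteqP; split=> [_ [i _ <-]|t /= /(@tnthP _ _ (in_tuple _))[i ->]].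
  exact: mem_tnth.
by exists i.
Qed.

Section Subgroups.
Local Open Scope group_scope.
Variable G : groupType.
Implicit Types (H S : set G).

Lemma subgroup_gen S : subgroup (gen S).
Proof.
split=> [H [[]]//|x y xS yS H HS|x xS H HS]; have [[_ HM HV] _] := HS.
  by apply: HM; [apply: xS|apply: yS].
by apply: HV; apply: xS.
Qed.

End Subgroups.

(** * Coboundaries in the base group *)

Section Coboundaries.
Local Open Scope ring_scope.
Variable T : groupType.
Implicit Types (u v : {malg int[T]}) (a b s t : T) (H : set T).

Fact shift_is_additive a : additive (@shift int T a).
Proof.
by move=> u v; apply/malgP => c; rewrite !(mcoeffB, shiftE).
Qed.

HB.instance Definition _ a :=
  GRing.isAdditive.Build {malg int[T]} {malg int[T]} (shift a)
    (shift_is_additive a).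

Lemma shiftU a b (z : int) : shift a << z *g b >> = << z *g (a * b)%g >>.
Proof.
apply/malgP=> c; rewrite shiftE !mcoeffU.
by rewrite -(inj_eq (mulgI a) b) mulVKg.
Qed.

(** Extending the indicator function of [H] linearly by [mmap] gives additivity at once. *)
Definition sum_over H u : int := mmap idfun (fun t => `[< H t >]%:R) u.

HB.instance Definition _ H :=
  GRing.Additive.copy (sum_over H) (mmap idfun (fun t => `[< H t >]%:R)).

(** By additivity a monomial at [b] suffices; as [a] lies in [H], the elements [b] and [a * b] are
    both in [H] or both outside. *)
Lemma sum_over_shift H a u : subgroup H -> H a ->
  sum_over H (shift a u) = sum_over H u.
Proof.
case=> _ HM HV Ha; rewrite (monalgE u) !raddf_sum; apply: eq_bigr => b _ /=.
rewrite shiftU /sum_over !mmapU; congr (_ * _%:R); congr nat_of_bool.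
apply/asbool_equiv_eq; split=> [Hab|]; last exact: HM.
by rewrite -[b](mulKg a); apply: HM => //; apply: HV.
Qed.

(** The [a i] are fixed and only the [u i] vary, so sums and differences of such [v] need no further
    terms. *)
Definition coboundary n (a : 'I_n -> T) v : Prop :=
  exists u : 'I_n -> {malg int[T]}, v = \sum_(i < n) (shift (a i) (u i) - u i).

Variables (n : nat) (a : 'I_n -> T).

Lemma coboundary0 : coboundary a 0.
Proof. by exists (fun=> 0); rewrite big1// => i _; rewrite raddf0 subrr. Qed.

Lemma coboundaryB u v : coboundary a u -> coboundary a v -> coboundary a (u - v).
Proof.
move=> [u' ->] [v' ->]; exists (fun i => u' i - v' i).
rewrite -sumrB; apply: eq_bigr => i _.
rewrite [shift _ (_ - _)]raddfB !opprB addrACA [RHS]addrACA.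
by congr (_ + _); rewrite addrC.
Qed.

Lemma coboundaryD u v : coboundary a u -> coboundary a v -> coboundary a (u + v).
Proof.
move=> cu cv; rewrite -[v]opprK -[- v]sub0r.
by do 2 apply: coboundaryB => //; exact: coboundary0.
Qed.

Lemma coboundary_gen t s : gen (range a) t ->
  coboundary a (delta (t * s)%g - delta s).
Proof.
pose K := [set t | forall s, coboundary a (delta (t * s)%g - delta s)].
move=> tgen; suff : K t by apply.
apply: tgen; split; last first.
  move=> _ [i _ <-] r; exists (fun j => if j == i then delta r else 0).
  rewrite (bigD1 i)//= eqxx shiftU big1 ?addr0// => j /negPf->.
  by rewrite raddf0 subrr.
split=> [r|x y Kx Ky r|x Kx r].
- by rewrite mul1g subrr; exact: coboundary0.
(* Telescope through [delta (y * r)], using [Kx] at [y * r] and [Ky] at [r]. *)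
- rewrite -(subrK (delta (y * r)%g) (delta _)) -addrA -mulgA.
  exact: coboundaryD.
(* Up to sign, the goal is [Kx] at [x^-1 * r]. *)
rewrite -opprB -[X in coboundary a X]sub0r; apply: coboundaryB.
  exact: coboundary0.
by have := Kx (x^-1 * r)%g; rewrite mulVKg.
Qed.

Lemma sum_over_coboundary v : coboundary a v -> sum_over (gen (range a)) v = 0.
Proof.
case=> u ->; rewrite raddf_sum big1// => i _.
rewrite raddfB /= sum_over_shift ?subrr//.
  exact: subgroup_gen.
by apply: sub_gen_smallest; exists i.
Qed.

Lemma coboundary_xvec k (l : 'I_k -> T) :
  coboundary a (xvec l) <-> range l `<=` gen (range a).
Proof.
have xvecE : xvec l = \sum_(i < k) (delta (l i) - delta 1%g).
  by rewrite sumrB sumr_const card_ord.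
split=> [/sum_over_coboundary|lgen]; last first.
  rewrite xvecE; apply: (big_ind (coboundary a)); first exact: coboundary0.
    exact: coboundaryD.
  move=> i _; rewrite -[l i]mulg1; apply: coboundary_gen.
  by apply: lgen; exists i.
have [g1 _ _] := subgroup_gen (range a).
rewrite xvecE raddf_sum => sum0 _ [i _ <-]; apply: contrapT => nli.
(* With the sign reversed every term is 0 or 1, so a zero sum makes each term vanish; but the term
   at [i] is 1. *)
have : \sum_(j < k) (1 - `[< gen (range a) (l j) >]%:R : int) = 0.
  rewrite -[RHS]oppr0 -[in RHS]sum0 -sumrN; apply: eq_bigr => j _.
  by rewrite raddfB /= /sum_over !mmapU !mul1r (asboolT g1) opprB.
move/psumr_eq0P => /(_ _ i isT); rewrite (asboolF nli) subr0.
by move=> H; have/eqP := H (fun j _ => ltac:(by case: asbool)).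
Qed.

End Coboundaries.

(** * Mixed commutators of the wreath product *)

Section MixedCommutators.
Local Open Scope ring_scope.
Variable T : groupType.
Implicit Types u v : {malg int[T]}.

Lemma wreathM u v (a b : T) :
  (Wreath u a * Wreath v b)%g = Wreath (u + shift a v) (a * b)%g.
Proof. by []. Qed.

Lemma wreathV u (a : T) : (Wreath u a)^-1%g = Wreath (- shift a^-1%g u) a^-1%g.
Proof. by []. Qed.

Lemma of_baseD u v : of_base (u + v) = (of_base u * of_base v)%g.
Proof.
rewrite /of_base wreathM mulg1; congr Wreath.
by apply/malgP => t; rewrite !mcoeffD shiftE invg1 mul1g.
Qed.

Lemma of_base_sum n (u : 'I_n -> {malg int[T]}) :
  of_base (\sum_(i < n) u i) = (\prod_(i < n) of_base (u i))%g.
Proof. exact: (big_morph (@of_base int T) of_baseD). Qed.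

Lemma of_base_inj : injective (@of_base int T).
Proof. by move=> u v []. Qed.

Lemma mixed_commutator_of_base (c : wreath int T) :
  mixed_commutators (@base_subgroup int T) c <->
  exists a u, c = of_base (shift a u - u).
Proof.
(* The base component [w] of [g] cancels because the base group is commutative. *)
have comm (g : wreath int T) u :
    (g * of_base u * g^-1 * (of_base u)^-1)%g = of_base (shift (wtop g) u - u).
  case: g => w a; rewrite /of_base !wreathV !wreathM /=.
  rewrite mulg1 mulgV invg1 mulg1; congr Wreath; apply/malgP => t.
  rewrite !(mcoeffD, mcoeffN, shiftE) !invgK !invg1 !mul1g mulVKg.
  by rewrite [w@_t + _]addrC addrK.
split=> [[g [_ [[u _ <-] ->]]]|[a [u ->]]].
  by exists (wtop g), u; rewrite comm.
by exists (Wreath 0 a), (of_base u); split; [exists u|rewrite comm].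
Qed.

Lemma prod_mixed_commutators n v :
  (exists c : 'I_n -> wreath int T,
    (forall i, mixed_commutators (@base_subgroup int T) (c i)) /\
    of_base v = (\prod_(i < n) c i)%g) <->
  (exists a : 'I_n -> T, coboundary a v).
Proof.
split=> [[c [cN vE]]|[a [u ->]]]; last first.
  exists (fun i => of_base (shift (a i) (u i) - u i)); split.
    by move=> i; apply/mixed_commutator_of_base; exists (a i), (u i).
  exact: of_base_sum.
have [a aE] := choice (fun i => (mixed_commutator_of_base (c i)).1 (cN i)).
have [u uE] := choice aE.
exists a, u; apply: of_base_inj; rewrite vE of_base_sum.
by apply: eq_bigr => i _; exact: uE.
Qed.

(** Here the wreath product disappears: what remains is a generation problem in [T], comparable with
    the intermediate rank. *)
Lemma prod_mixed_commutators_xvec n k (l : 'I_k -> T) :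
  (exists c : 'I_n -> wreath int T,
    (forall i, mixed_commutators (@base_subgroup int T) (c i)) /\
    of_base (xvec l) = (\prod_(i < n) c i)%g) <->
  (exists a : 'I_n -> T, range l `<=` gen (range a)).
Proof.
by split=> [/prod_mixed_commutators|] [a /coboundary_xvec al];
  [|apply/prod_mixed_commutators]; exists a.
Qed.

End MixedCommutators.

Theorem theorem1p1 (Gamma : groupType) (k : nat) (hk : (0 < k)%N)
    (lambda : 'I_k -> Gamma) (hlambda : forall i, lambda i <> 1%g) :
  let N : set (wreath int Gamma) := @base_subgroup int Gamma in
  let Lambda : set Gamma := gen (range lambda) in
  let x : wreath int Gamma := of_base (xvec lambda) in
  mixed_commutator_subgroup N x /\ mixed_cl N x = int_rk Lambda.
Proof.
move=> N Lambda x; rewrite {}/x; split.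
  (* Taking [a] to be [lambda] itself writes the element with [k] mixed commutators. *)
  have [c [cN ->]] := (prod_mixed_commutators_xvec k lambda).2
    (ex_intro _ lambda (@sub_gen_smallest _ _ _)).
  have [g1 gM _] := subgroup_gen (mixed_commutators N).
  apply: (big_ind (gen (mixed_commutators N))) => // i _.
  exact: sub_gen_smallest (cN i).
apply/eqP; rewrite eq_le; apply/andP; split; apply: le_einf => y.
  move=> [K [Ksub LK] <-]; apply: le_einf => _ [S SK <-].
  (* An infinite generating set gives the bound [None], which is trivial. *)
  case SE : (ecard S) => [n|]; last by case: (mixed_cl _ _).
  have [a aS] := ecard_range_ex SE.
  apply: einf_le; exists n => //; apply/prod_mixed_commutators_xvec.
  exists a; rewrite aS SK; apply: subset_trans LK.
  exact: sub_gen_smallest.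
(* The subgroup generated by [a] contains [Lambda] and has rank at most [n], so it bounds the
   intermediate rank. *)
move=> [n /prod_mixed_commutators_xvec[a la] <-].
apply: le_trans (ecard_range_le a).
apply: (@le_trans _ _ (rk (gen (range a)))); last first.
  by apply: einf_le; exists (range a).
apply: einf_le; exists (gen (range a)) => //; split.
  exact: subgroup_gen.
by apply: smallest_sub; first exact: subgroup_gen.
Qed.
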